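(* For every infinite cardinal $\kappa$ there exists a Knut Vic design of order $\kappa$: that is, there exist an abelian group $A$ of order $\kappa$ and a Latin square $L:A\times A\to X$ such that for every $k\in A$, the left diagonal $\{(i,k+i):i\in A\}$ and the right diagonal $\{(i,k-i):i\in A\}$ each contain every symbol of $X$ exactly once.
   Context: A Latin square $L:A\times A\to X$ (rows and columns indexed by $A$) is one in which every row map $j\mapsto L(i,j)$ and every column map $i\mapsto L(i,j)$ is a bijection onto $X$. *)

(* Defs.v *)
From mathcomp Require Import all_boot all_algebra.
From mathcomp Require Import all_classical.

Set Implicit Arguments.
Unset Strict Implicit.
Unset Printing Implicit Defensive.

Import GRing.Theory.
Local Open Scope classical_set_scope.
Local Open Scope ring_scope.

Definition latin_square (A X : Type) (L : A * A -> X) : Prop :=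
  (forall i : A, bijective (fun j : A => L (i, j))) /\
  (forall j : A, bijective (fun i : A => L (i, j))).

Definition left_diagonal (A : zmodType) (k : A) : set (A * A) :=
  [set (i, k + i) | i in [set: A]].

Definition right_diagonal (A : zmodType) (k : A) : set (A * A) :=
  [set (i, k - i) | i in [set: A]].

Definition each_symbol_once (C X : Type) (L : C -> X) (D : set C) : Prop :=
  forall x : X, exists! c : C, D c /\ L c = x.

Definition knut_vic (A : zmodType) (X : Type) (L : A * A -> X) : Prop :=
  latin_square L /\
  (forall k : A, each_symbol_once L (left_diagonal k) /\
                 each_symbol_once L (right_diagonal k)).

(* Main.v *)
(** If [2] and [3] are invertible scalars of a module [A], the square
    [L (i, j) = i + 2 j] restricts to an affine bijection on every row, column,
    left and right diagonal, the slopes being [2], [1], [3] and [-1].  The free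
    rational vector space on an infinite set has the cardinality of that set,
    because its elements are coded by finite sequences of pairs; this rests on
    [K * K] having the cardinality of [K], which is derived from Zorn's lemma. *)

Require Import Defs.
From mathcomp Require Import all_boot all_algebra.
From mathcomp Require Import all_classical.
From mathcomp.multinomials Require Import freeg.

Set Implicit Arguments.
Unset Strict Implicit.
Unset Printing Implicit Defensive.

Import GRing.Theory.
Local Open Scope classical_set_scope.
Local Open Scope ring_scope.
Local Open Scope card_scope.

(** * Comparability of cardinals *)

Lemma rel_card_le (T U : Type) (A : set T) (B : set U) (G : T -> U -> Prop) :
  (forall x, A x -> exists2 y, B y & G x y) ->
  (forall x x' y, G x y -> G x' y -> x = x') ->
  A #<= B.
Proof.
(* Choice needs a default value at points outside [A]; an empty [U] has none, but then [A] is empty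
   too. *)
elim/Ppointed: U => U in B G *.
  move=> GB _; suff -> : A = set0 by exact: card_ge0.
  by rewrite -subset0 => x /GB [] y; case: (no y).
move=> GB Ginj.
have /choice [f fP] : forall x, exists y, A x -> B y /\ G x y.
  move=> x; have [/GB [y By Gxy]|nAx] := pselect (A x); first by exists y.
  by exists point.
apply/pcard_leP/injfunPex; exists f => [x /fP []//|x y].
rewrite !inE => /fP [_ Gx] /fP [_ Gy] fxy.
by apply: Ginj Gx _; rewrite fxy.
Qed.

Lemma injective_card_le (T U : Type) (f : T -> U) :
  injective f -> [set: T] #<= [set: U].
Proof.
move=> finj; apply: (@rel_card_le _ _ _ _ (fun x y => f x = y)) => [x _|x x' y].
  by exists (f x).
by move=> <- /finj.
Qed.

(** Zorn gives a maximal partial bijection from [A] to [B]. It exhausts [A] or [B], since otherwise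
    an unmatched pair [(a, b)] could be added. *)
Lemma card_le_total (T U : Type) (A : set T) (B : set U) :
  (A #<= B) \/ (B #<= A).
Proof.
(* [G] is the graph of a partial bijection. The condition involves only two points at a time, so it
   passes to unions of chains. *)
pose P (G : set (T * U)) := forall p q, G p -> G q ->
  (A p.1 /\ B p.2) /\ (p.1 = q.1 <-> p.2 = q.2).
have [F sF totF|G [PG maxG]] := @Zorn_bigcup _ P.
  move=> p q [X FX Xp] [Y FY Yq].
  have [XY|YX] := totF _ _ FX FY.
    exact: sF _ FY _ _ (XY _ Xp) Yq.
  exact: sF _ FX _ _ Xp (YX _ Yq).
have [domG|/existsNP [a /not_implyP [Aa aG]]] :=
    pselect (forall x, A x -> exists y, G (x, y)).
  left; apply: (@rel_card_le _ _ _ _ (fun x y => G (x, y))).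
    by move=> x /domG [y Gxy]; exists y => //; have [[]] := PG _ _ Gxy Gxy.
  by move=> x x' y Gx Gx'; have [_ [_ /(_ erefl)]] := PG _ _ Gx Gx'.
right; apply: (@rel_card_le _ _ _ _ (fun y x => G (x, y))); last first.
  by move=> y y' x Gy Gy'; have [_ [/(_ erefl)]] := PG _ _ Gy Gy'.
move=> b Bb; apply: contrapT => bG.
apply: (maxG (G `|` [set (a, b)])).
  split; first by move=> p; left.
  by move=> /(_ (a, b)) aGb; apply: aG; exists b; apply: aGb; right.
have new p : G p -> p.1 <> a /\ p.2 <> b.
  case: p => x y Gxy /=; split=> E.
    by apply: aG; exists y; rewrite -E.
  apply: bG; exists x; last by rewrite -E.
  by have [[]] := PG _ _ Gxy Gxy.
move=> p q [Gp|->] [Gq|->] //=; first exact: PG.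
- have [pa pb] := new _ Gp; have [AB _] := PG _ _ Gp Gp.
  by split=> //; split.
- have [qa qb] := new _ Gq; split=> //.
  by split=> E; [case: qa | case: qb].
Qed.

(** * Squares of infinite cardinals *)

Definition pairing_on (K : Type) (S : set K) (f : K * K -> K) :=
  set_fun (S `*` S) S f /\ set_inj (S `*` S) f.

(** The starting point for Zorn: a countable subset carries the pairing transported from [nat]. *)
Lemma infinite_pairing_on (K : pointedType) : infinite_set [set: K] ->
  exists (S : set K) f a b, [/\ pairing_on S f, S a, S b & a <> b].
Proof.
move=> /infiniteP /pcard_injP [g /in2TT ginj].
have /choice [g' gK] : forall x, exists n, range g x -> g n = x.
  move=> x; have [[n _ <-]|nx] := pselect (range g x); first by exists n.
  by exists 0%N.
exists (range g), (fun q => g (pickle (g' q.1, g' q.2))), (g 0%N), (g 1%N).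
split; [|by exists 0%N|by exists 1%N|by move/ginj].
split=> [q _|[x y] [x' y']]; first by eexists.
move=> /set_mem [/= Sx Sy] /set_mem [/= Sx' Sy'].
move=> /ginj /(pcan_inj pickleK) [E1 E2].
by rewrite -(gK _ Sx) -(gK _ Sy) E1 E2 !gK.
Qed.

(** As [a <> b], the maps [f (a, -)] and [f (b, -)] have disjoint images in [S]: one houses [S], the
    other a copy of the rest of [D]. *)
Lemma pairing_on_absorb (K : pointedType) (S D : set K) f a b :
  pairing_on S f -> S a -> S b -> a <> b -> D #<= S ->
  exists e, set_fun (S `|` D) S e /\ set_inj (S `|` D) e.
Proof.
move=> [fS finj] Sa Sb ab /pcard_leP/injfunPex [k kS kinj].
have kS' x : (S `|` D) x -> ~ S x -> S (k x) by case=> // /kS.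
exists (fun x => if pselect (S x) then f (a, x) else f (b, k x)); split.
  by move=> x SDx; case: pselect => Sx; apply: fS; split=> //=; exact: kS'.
move=> x y /set_mem SDx /set_mem SDy.
case: pselect => Sx; case: pselect => Sy /finj.
all: rewrite !in_setX /= !mem_set //; try exact: kS'.
all: move=> /(_ isT isT) [] //; try by move=> /esym.
apply: kinj; rewrite inE.
- by case: SDx.
- by case: SDy.
Qed.

(* Take a maximal pairing [f] on a set [S].  If the complement of [S] injects
   into [S], two disjoint copies of [S] inside [S] (via [f (a, -)] and
   [f (b, -)]) show that [K] injects into [S].  Otherwise [S] has a copy [t @` S]
   in its complement; pairs outside [S `*` S] can then be sent to [t @` S], which
   extends [f] and contradicts maximality. *)
Lemma infinite_card_square (K : pointedType) :
  infinite_set [set: K] -> [set: K * K] #<= [set: K].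
Proof.
move=> /infinite_pairing_on [S0 [f0 [a [b [pf0 S0a S0b ab]]]]].
pose good (p : set K * (K * K -> K)) :=
  [/\ pairing_on p.1 p.2, p.1 a & p.1 b].
(* Pairings are total functions compared only on the smaller square, so [R] is not antisymmetric and
   Zorn is used for preorders. *)
pose R (s t : {p | good p}) := `[< (sval s).1 `<=` (sval t).1 /\
  {in (sval s).1 `*` (sval s).1, (sval s).2 =1 (sval t).2} >].
have good0 : good (S0, f0) by [].
have Rxx s : R s s by apply/asboolP; split.
have Rtr r s t : R r s -> R s t -> R r t.
  move=> /asboolP [rs frs] /asboolP [st fst]; apply/asboolP; split.
    exact: subset_trans rs st.
  move=> q Sq; rewrite frs // fst //.
  by move/set_mem: Sq => [q1 q2]; apply/mem_set; split; exact: rs.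
have [A totA|[[S f] [/= pf Sa Sb]] maxS] :=
    @ZL_preorder _ (exist _ _ good0 : {p | good p}) R Rxx Rtr.
  have [[s0 As0]|A0] := pselect (exists s, A s); last first.
    by exists (exist _ _ good0) => s As; case: A0; exists s.
  pose D (s : {p | good p}) := (sval s).1.
  pose U := [set x | exists2 s, A s & D s x].
  have RD s t : R s t -> D s `<=` D t by case/asboolP.
  have common s t : A s -> A t -> exists2 r, A r & R s r /\ R t r.
    by move=> As At; have [st|ts] := totA _ _ As At; [exists t | exists s].
  have UU q : (U `*` U) q -> exists2 s, A s & (D s `*` D s) q.
    move=> [[s As sq] [t At tq]]; have [r Ar [/RD sr /RD tr]] := common s t As At.
    by exists r => //; split; [exact: sr | exact: tr].
  (* Members of the chain agree where they overlap, so they glue to one [F]; [a] is the default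
     value on pairs that no member covers. *)
  have /choice [F FE] : forall q, exists z, forall s, A s -> (D s `*` D s) q ->
      z = (sval s).2 q.
    move=> q; have [[s As sq]|nq] := pselect (exists2 s, A s & (D s `*` D s) q).
      exists ((sval s).2 q) => t At tq.
      have [/asboolP [_ E]|/asboolP [_ E]] := totA _ _ As At.
        exact/E/mem_set.
      exact/esym/E/mem_set.
    by exists a => s As sq; case: nq; exists s.
  have goodU : good (U, F).
    split; last 2 first.
    - by exists s0 => //; case: (svalP s0).
    - by exists s0 => //; case: (svalP s0).
    split=> /= [q /UU [s As sq]|q q'].
      by exists s => //; rewrite (FE q s) //; have [[+ _] _ _] := svalP s; exact.
    move=> /set_mem /UU [s As sq] /set_mem /UU [t At tq].
    have [r Ar [/RD sr /RD tr]] := common s t As At.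
    have rq : (D r `*` D r) q by case: sq => *; split; exact: sr.
    have rq' : (D r `*` D r) q' by case: tq => *; split; exact: tr.
    rewrite (FE q r) // (FE q' r) //; have [[_ rinj] _ _] := svalP r.
    by apply: rinj; exact: mem_set.
  exists (exist _ _ goodU) => s As; apply/asboolP; split=> /= [x sx|q /set_mem sq].
    by exists s.
  by rewrite (FE q s).
have [fS finj] := pf.
have [SC|/pcard_leP/injfunPex [t tC tinj]] := card_le_total (~` S) S.
  have [e []] := pairing_on_absorb pf Sa Sb ab SC.
  rewrite setUv => eS /in2TT einj.
  apply: (@injective_card_le _ _ (fun q => f (e q.1, e q.2))) => -[x y] [x' y'].
  move/finj; rewrite !in_setX /= !mem_set //; try exact: eS.
  by move=> /(_ isT isT) [/einj -> /einj ->].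
pose W := S `|` t @` S.
have [e [eS einj]] := pairing_on_absorb pf Sa Sb ab (card_image_le t S).
(* On a new pair, [e] compresses both entries into [S], [f] pairs them, and [t] moves the result out
   of [S], away from all old values. *)
pose F q := if pselect ((S `*` S) q) then f q else t (f (e q.1, e q.2)).
have fe q : (W `*` W) q -> S (f (e q.1, e q.2)).
  by case=> q1 q2; apply: fS; split; exact: eS.
have goodW : good (W, F).
  split; [|by left|by left]; split=> /= [q Wq|q q'].
    rewrite /F; case: pselect => [Sq|nSq] /=; first by left; exact: fS.
    by right; exists (f (e q.1, e q.2)) => //; exact: fe.
  move=> /set_mem Wq /set_mem Wq'; rewrite /F.
  case: pselect => Sq; case: pselect => Sq' /= E.
  - by apply: finj E; exact: mem_set.
  - by have /tC := fe _ Wq'; rewrite -E; case; exact: fS.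
  - by have /tC := fe _ Wq; rewrite E; case; exact: fS.
  have {}E := tinj _ _ (mem_set (fe _ Wq)) (mem_set (fe _ Wq')) E.
  case: q q' E Wq Wq' {Sq Sq'} => [x y] [x' y'] /= E [/= Wx Wy] [/= Wx' Wy'].
  move/finj: E; rewrite !in_setX /= !mem_set //; try exact: eS.
  by move=> /(_ isT isT) [Ex Ey]; congr (_, _); apply: einj; rewrite ?mem_set.
have /maxS/asboolP [/= WS _] :
    R (exist good (S, f) (And3 pf Sa Sb)) (exist good (W, F) goodW).
  apply/asboolP; split=> /= [x|q /set_mem Sq]; first by left.
  by rewrite /F; case: pselect.
by have /tC := Sa; case; apply: WS; right; exists a.
Qed.

(** * Cardinality of the free rational vector space *)

Lemma infinite_card_setX (T U : Type) (K : pointedType) :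
  infinite_set [set: K] -> [set: T] #<= [set: K] -> [set: U] #<= [set: K] ->
  [set: T * U] #<= [set: K].
Proof.
move=> /infinite_card_square KK /pcard_injP [f /in2TT finj].
move=> /pcard_injP [g /in2TT ginj]; apply: card_le_trans KK.
apply: (@injective_card_le _ _ (fun q => (f q.1, g q.2))) => -[x y] [x' y'] /=.
by move=> [/finj -> /ginj ->].
Qed.

(** A sequence is coded by its iterated pairing together with its length; the length is kept because
    [point] may itself be a value of [p]. *)
Lemma infinite_card_seq (K : pointedType) :
  infinite_set [set: K] -> [set: seq K] #<= [set: K].
Proof.
move=> infK; have /pcard_injP [p /in2TT pinj] := infinite_card_square infK.
have natK : [set: nat] #<= [set: K] by exact/infiniteP.
apply: card_le_trans (infinite_card_setX infK natK (card_lexx _)).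
pose fold := foldr (fun x y => p (x, y)) point.
apply: (@injective_card_le _ _ (fun s => (size s, fold s))).
elim=> [|x s IHs] [|y t] //= [st] /pinj [-> E].
by congr (_ :: _); apply: IHs; rewrite st E.
Qed.

Lemma infinite_card_freeg (K : pointedType) :
  infinite_set [set: K] -> [set: {freeg K / rat}] #= [set: K].
Proof.
move=> infK; rewrite card_eq_le; apply/andP; split.
  have natK : [set: nat] #<= [set: K] by exact/infiniteP.
  have ratK : [set: rat] #<= [set: K].
    by apply: card_le_trans natK; exact: (injective_card_le (pcan_inj pickleK)).
  have /pcard_injP [c /in2TT cinj] :=
    infinite_card_setX infK ratK (card_lexx [set: K]).
  apply: card_le_trans (infinite_card_seq infK).
  (* [repr] picks a representative sequence of coefficient-generator pairs, and [c] codes each pair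
     in [K]. *)
  apply: (@injective_card_le _ _ (map c \o \val \o repr)).
  exact: inj_comp (inj_comp (inj_map cinj) val_inj) (can_inj reprK).
(* Distinct generators differ in their coefficient at [y]. *)
apply: (@injective_card_le _ _ (fun x => Freeg [:: (1, x)])) => x y.
move=> /(congr1 (coeff y)).
by rewrite !coeffU !mul1r eqxx; case: eqP.
Qed.

(** * The affine Latin square *)

Lemma affine_bijective (F : fieldType) (V : lmodType F) (c : F) (v : V) :
  c != 0 -> bijective (fun i => c *: i + v).
Proof.
move=> c0; exists (fun x => c^-1 *: (x - v)) => x.
  by rewrite addrK scalerK.
by rewrite scalerKV ?subrK.
Qed.

Lemma each_symbol_once_image (I C X : Type) (g : I -> C) (L : C -> X) :
  bijective (L \o g) -> each_symbol_once L [set g i | i in [set: I]].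
Proof.
move=> [h hK Kh] x; exists (g (h x)); split=> [|c [[i _ <-] <-]].
  by split; [exists (h x) | exact: Kh].
by congr g; exact: hK.
Qed.

Lemma knut_vic_lmod (F : fieldType) (V : lmodType F) :
  2%:R != 0 :> F -> 3%:R != 0 :> F ->
  knut_vic (fun p : V * V => p.1 + 2%:R *: p.2).
Proof.
move=> two three.
have slope (c : F) (v : V) g : c != 0 -> (forall i, c *: i + v = g i) -> bijective g.
  by move=> /affine_bijective gbij /funext <-.
split; first split=> [i|j].
- by apply: (slope 2%:R i) => // j; rewrite addrC.
- by apply: (slope 1 (2%:R *: j)) => [|i]; rewrite ?oner_eq0 ?scale1r.
(* At [(i, k + i)] the square takes the value [3 i + 2 k], at [(i, k - i)] the value [- i + 2 k]. *)
move=> k; split; apply: each_symbol_once_image.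
- apply: (slope 3%:R (2%:R *: k)) => //= i.
  by rewrite scalerDr addrCA [RHS]addrC -natr1 scalerDl scale1r [i + _]addrC.
- apply: (slope (-1) (2%:R *: k)) => /= [|i]; first by rewrite oppr_eq0 oner_eq0.
  rewrite scalerBr addrCA [RHS]addrC; congr (_ + _).
  by rewrite scaleN1r scaler_nat mulr2n opprD addrA subrr add0r.
Qed.

Theorem theorem5p10 (K : Type) (infK : infinite_set [set: K]) :
  exists (A : zmodType) (X : Type) (L : A * A -> X),
    ([set: A] #= [set: K]) /\ knut_vic L.
Proof.
elim/Ppointed: K => K in infK *; first by rewrite emptyE in infK.
exists {freeg K / rat}, {freeg K / rat}, (fun p => p.1 + 2%:R *: p.2).
by split; [exact: infinite_card_freeg | exact: knut_vic_lmod].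
Qed.
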